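(* (i) For all positive integers $k$, $\ell$ and $n$ with $k\geq 2$, we have $$F(k,\ell,n)\leq\frac{2}{k}\left(\frac{e}{k-1}\right)^{k-1}n^{k-1}.$$ (ii) Given positive integers $k$ and $\ell$, if $f(k,\ell)$ exists, then for all large enough $n$ we have $$F(k,\ell,n)\geq \frac{n}{f(k,\ell)\,[\log n-\log f(k,\ell)+2]}-\frac{f(k,\ell)}{\log f(k,\ell)-4}+1.$$
   Context: $S_n$ denotes the set of permutations of $\{1,2,\ldots,n\}$ written in one-line notation $p=(p_1,p_2,\ldots,p_n)$. A subsequence of $p$ of length $k$ is a sequence $(p_{i_1},\ldots,p_{i_k})$ with $i_1<\cdots<i_k$. A sequence $(a_1,a_2,\ldots,a_k)$ of positive integers is $\ell$-additive if $a_1+a_2+\cdots+a_k=\ell a_1$ or $a_1+a_2+\cdots+a_k=\ell a_k$. For positive integers $k$ and $\ell$, $f(k,\ell)$ denotes the smallest positive integer $n$, if it exists, such that every $p\in S_n$ has an $\ell$-additive subsequence of length $k$. For $p\in S_n$, $F_p(k,\ell,n)$ is the number of $\ell$-additive subsequences of length $k$ in $p$, and $F(k,\ell,n)=\min_{p\in S_n}F_p(k,\ell,n)$. Here $\log$ is the natural logarithm and $e$ is its base. ''For all large enough $n$'' means for all $n\geq N$ for some $N$ that may depend on $k$ and $\ell$. *)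

(* Defs.v *)
From mathcomp Require Import all_boot all_order all_algebra all_fingroup.
From mathcomp Require Import all_reals all_analysis.

Set Implicit Arguments.
Unset Strict Implicit.
Unset Printing Implicit Defensive.

Local Open Scope nat_scope.

(* Only meaningful for nonempty sequences. *)
Definition ell_additive (l : nat) (a : seq nat) : bool :=
  (sumn a == l * head 0 a) || (sumn a == l * last 0 a).

(* Elements of 'S_n permute {0, .., n.-1}; both positions and values are
   shifted by one with respect to one-line notation on {1, .., n}, and only the
   shift of the values matters. *)
Definition entry n (p : 'S_n) (i : 'I_n) : nat := (p i).+1.

(* A subsequence of length k is represented by its strictly increasing tuple of
   positions; since the entries of a permutation are distinct, counting position
   tuples is the same as counting the sequences of entries. *)
Definition additive_subseqs k l n (p : 'S_n) : {set k.-tuple 'I_n} :=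
  [set t : k.-tuple 'I_n |
    sorted ltn [seq val i | i <- t] && ell_additive l [seq entry p i | i <- t]].

Definition unavoidable k l n : Prop :=
  forall p : 'S_n, exists t : k.-tuple 'I_n, t \in additive_subseqs k l p.

(* The relation "f(k, l) exists and is equal to m". *)
Definition is_f k l m : Prop :=
  [/\ 0 < m, unavoidable k l m &
      forall n, 0 < n -> unavoidable k l n -> m <= n].

Definition Fp k l n (p : 'S_n) : nat := #|additive_subseqs k l p|.

Definition F k l n : nat :=
  Fp k l [arg min_(p < (1%g : 'S_n)) Fp k l p].

(* Main.v *)
Require Import Defs.
From mathcomp Require Import all_boot all_order all_algebra all_fingroup.
From mathcomp Require Import all_reals all_analysis.
From mathcomp Require Import zify ring lra.

(** The upper bound is an averaging argument. For a fixed increasing tuple of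
    [k] positions and a uniformly random permutation, additivity with respect
    to the first (or last) entry [v] reads [S = (l - 1) * v], where [S > 0] is
    the sum of the other [k - 1] entries, so the value at one position is
    determined by the values at the others. Such an event has probability at
    most [1 / (n - k + 1)] ([card_perms_determined]). Summing over the
    ['C(n, k)] tuples and the two cases, the expected number of additive
    subsequences is at most [2 'C(n, k) / (n - k + 1) = (2 / k) 'C(n, k - 1)]
    ([F_le_bin]), and [m ^ m <= m! e ^ m] turns the binomial coefficient into
    the stated power ([bin_le_expR]).

    For the lower bound let [f = f(k, l)]. Whenever [d * f <= n], the entries
    [d, 2d, .., fd] of a permutation of [{1, .., n}] are ordered like some
    permutation of [{1, .., f}], and additivity is invariant under scaling, so
    an additive subsequence can be found among these multiples of [d]
    ([dilated_additive]). A given subsequence arises from at most [f] values of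
    [d], because its first entry is [d * j] with [1 <= j <= f], and [j] then
    determines [d]. Hence [F(k, l, n) >= floor(n / f) / f] ([divn_le_F]). This
    is linear in [n], whereas the claimed bound is of order [n / log n], so it
    follows for all large [n] ([eventually_le_linear]). *)

Import Order.TTheory GRing.Theory Num.Theory.
Local Open Scope nat_scope.

(** Precomposing [p] in [E] with the transposition of [x0] and [j], for [j]
    outside [B], does not change the values on [B]. From the product [p] can be
    recovered: the values on [B] determine [p x0], the preimage of this value
    is [j], and [j] determines [p]. So a single permutation encodes the pair
    [(p, j)]. *)
Lemma card_perms_determined (T : finType) (x0 : T) (B : {set T})
    (E : {set {perm T}}) :
  x0 \notin B ->
  {in E &, forall p q : {perm T}, {in B, p =1 q} -> p x0 = q x0} ->
  #|E| * #|~: B| <= #|T|`!.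
Proof.
move=> x0B detE; rewrite -cardsX.
have -> : #|T|`! = #|{: {perm T}}|.
  by rewrite -cardsT -card_perm; apply: eq_card => p; rewrite inE; apply/subsetP.
pose swap (pj : {perm T} * T) := (tperm x0 pj.2 * pj.1)%g.
apply: (@leq_card_in _ _ swap) => -[p j] [q j']; rewrite !inE /=.
move=> /andP[pE jB] /andP[qE j'B]; rewrite /swap /= => eq_swap.
have swapE x : p (tperm x0 j x) = q (tperm x0 j' x).
  by have /permP/(_ x) := eq_swap; rewrite !permM.
have eq_x0 : p x0 = q x0.
  apply: detE => // b bB; have := swapE b.
  by rewrite !tpermD //; apply: contraTneq bB => <-.
have eq_j : j = j'.
  have := swapE j; rewrite tpermR eq_x0 => /perm_inj x0E.
  by apply: (@perm_inj _ (tperm x0 j')); rewrite -x0E tpermR.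
by rewrite eq_j in eq_swap *; rewrite (mulgI _ _ _ eq_swap).
Qed.

(** The equation says that the [k - 1 > 0] other entries have sum
    [(l - 1) * entry p x0]. That sum is positive, hence so is [l - 1], and the
    other entries determine [entry p x0]. *)
Lemma card_perms_sum_eq k l n (t : seq 'I_n) (x0 : 'I_n) :
  1 < k -> size t = k -> uniq t -> x0 \in t ->
  #|[set p : 'S_n | sumn [seq entry p i | i <- t] == l * entry p x0]|
    * (n - k.-1) <= n`!.
Proof.
move=> k_gt1 size_t uniq_t tx0.
pose B := [set i in t] :\ x0.
have cardB : #|B| = k.-1.
  have := cardsD1 x0 [set i in t].
  by rewrite inE tx0 cardsE (card_uniqP uniq_t) size_t -/B => ->.
have -> : n - k.-1 = #|~: B| by rewrite cardsCs setCK card_ord cardB.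
rewrite -[n in n`!]card_ord.
apply: (@card_perms_determined _ x0); first by rewrite !inE eqxx.
move=> p q; rewrite !inE => /eqP sum_p /eqP sum_q eqB.
have sumE (r : 'S_n) : sumn [seq entry r i | i <- t] =
    entry r x0 + \sum_(i in B) entry r i.
  rewrite sumnE big_map big_uniq //= (bigD1 x0) //=; congr (_ + _).
  by apply: eq_bigl => i; rewrite !inE andbC.
have eqS : \sum_(i in B) entry p i = \sum_(i in B) entry q i.
  by apply: eq_bigr => i iB; rewrite /entry eqB.
have S_gt0 : 0 < \sum_(i in B) entry q i.
  have /card_gt0P[i iB] : 0 < #|B| by rewrite cardB; lia.
  by rewrite (bigD1 i).
rewrite !sumE eqS in sum_p sum_q.
apply/val_inj/succn_inj; rewrite -!/(entry _ _).
move: (entry p x0) (entry q x0) (\sum_(i in B) _) sum_p sum_q S_gt0.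
move=> v w S; case: (ltngtP v w); nia.
Qed.

Lemma card_perms_additive k l n (t : k.-tuple 'I_n) :
  1 < k -> uniq t ->
  #|[set p : 'S_n | ell_additive l [seq entry p i | i <- t]]| * (n - k.-1)
    <= 2 * n`!.
Proof.
move=> k_gt1 uniq_t; have := size_tuple t.
case def_t: (tval t) uniq_t => [|x s] uniq_t size_t; first by simpl in size_t; lia.
have in_x : x \in x :: s by rewrite mem_head.
have lb := card_perms_sum_eq _ l _ _ _ k_gt1 size_t uniq_t in_x.
have ub := card_perms_sum_eq _ l _ _ _ k_gt1 size_t uniq_t (mem_last x s).
rewrite mul2n -addnn; apply: leq_trans (leq_add lb ub); rewrite -mulnDl leq_mul2r.
apply/orP; right; apply: leq_trans (leq_card_setU _ _); apply: subset_leq_card.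
by apply/subsetP => p; rewrite !inE /ell_additive /= last_map.
Qed.

Lemma F_le_Fp k l n (p : 'S_n) : F k l n <= Fp k l p.
Proof. by rewrite /F; case: arg_minnP => // q _; apply. Qed.

(** Double counting of the pairs formed by a permutation and an increasing
    tuple of positions whose entries are additive. *)
Lemma sum_Fp_le k l n : 1 < k ->
  (\sum_(p : 'S_n) Fp k l p) * (n - k.-1) <= 'C(n, k) * (2 * n`!).
Proof.
move=> k_gt1; pose I := [set t : k.-tuple 'I_n | sorted ltn [seq val i | i <- t]].
have -> : \sum_(p : 'S_n) Fp k l p =
    \sum_(t in I) #|[set p : 'S_n | ell_additive l [seq entry p i | i <- t]]|.
  transitivity (\sum_(p : 'S_n) \sum_(t in additive_subseqs k l p) 1).
    by apply: eq_bigr => p _; rewrite sum1_card.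
  rewrite (exchange_big_dep (mem I)) /=; last first.
    by move=> p t _; rewrite !inE => /andP[].
  apply: eq_bigr => t tI; rewrite -sum1_card; apply: eq_bigl => p.
  by rewrite !inE; move: tI; rewrite !inE => ->.
rewrite big_distrl /= -card_ltn_sorted_tuples -sum_nat_const.
apply: leq_sum => t; rewrite inE ltn_sorted_uniq_leq => /andP[uniq_t _].
by apply: card_perms_additive; rewrite // (map_inj_uniq val_inj) in uniq_t.
Qed.

(** The average over permutations bounds the minimum by
    [2 'C(n, k) / (n - k + 1)]; if [n < k] the division breaks down, but then
    there is no increasing tuple at all. *)
Lemma F_le_bin k l n : 1 < k -> k * F k l n <= 2 * 'C(n, k.-1).
Proof.
move=> k_gt1; have [n_small|n_large] := leqP n k.-1.
  suff : F k l n <= 'C(n, k) by rewrite bin_small; lia.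
  apply: leq_trans (F_le_Fp _ _ _ 1%g) _; rewrite -card_ltn_sorted_tuples.
  by apply/subset_leq_card/subsetP => t; rewrite !inE => /andP[].
have avg : F k l n * n`! <= \sum_(p : 'S_n) Fp k l p.
  rewrite mulnC -card_Sn -sum_nat_const.
  by apply: leq_sum => p _; apply: F_le_Fp.
have le_sum := sum_Fp_le k l n k_gt1.
have binE := mul_bin_left n k.-1; rewrite prednK in binE; last by lia.
have d_gt0 : 0 < (n - k.-1) * n`! by rewrite muln_gt0 fact_gt0; lia.
rewrite -(leq_pmul2r d_gt0).
have := leq_mul (leqnn k) (leq_trans (leq_mul avg (leqnn (n - k.-1))) le_sum).
have : k * ('C(n, k) * (2 * n`!)) = 2 * 'C(n, k.-1) * ((n - k.-1) * n`!).
  by rewrite mulnA binE; ring.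
by move=> ->; congr (_ <= _); ring.
Qed.

(** [q i] is the label whose position is the [i]-th smallest: [q] is the
    inverse of the rank function of [pos]. *)
Lemma standardization n f (pos : 'I_f -> 'I_n) : injective pos ->
  exists q : 'S_f, {homo (fun i => pos (q i)) : i j / i < j}.
Proof.
move=> pos_inj; pose below j := [set j' | pos j' < pos j].
have rank_lt j : #|below j| < f.
  rewrite -[X in _ < X]card_ord -cardsT; apply: proper_card.
  by rewrite properT; apply/eqP => /setP/(_ j); rewrite !inE ltnn.
pose rank j := Ordinal (rank_lt j).
have rank_mono i j : rank i < rank j -> pos i < pos j.
  apply: contraTT; rewrite -!leqNgt => le_ji; apply/subset_leq_card/subsetP => x.
  by rewrite !inE => /leq_trans; apply.
have rank_homo i j : pos i < pos j -> rank i < rank j.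
  move=> lt_ij; apply: proper_card; apply/properP; split.
    by apply/subsetP => x; rewrite !inE => /ltn_trans; apply.
  by exists i; rewrite !inE ?ltnn.
have rank_inj : injective rank.
  move=> i j eq_ij; apply/pos_inj/val_inj => /=.
  by case: (ltngtP (pos i) (pos j)) => // /rank_homo; rewrite eq_ij ltnn.
exists (perm rank_inj)^-1%g => i j lt_ij; apply: rank_mono.
by rewrite -![rank _](permE rank_inj) !permKV.
Qed.

Lemma ell_additive_scale l d (s : seq nat) :
  ell_additive l s -> ell_additive l [seq d * x | x <- s].
Proof.
case: s => [|a s] //; rewrite /ell_additive /= last_map.
have -> : sumn [seq d * x | x <- s] = d * sumn s.
  by rewrite !sumnE big_map big_distrr.
by rewrite -mulnDr !(mulnCA l) => /orP[] /eqP ->; rewrite eqxx ?orbT.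
Qed.

(** The pattern that the entries [d, 2d, .., fd] form inside [p] is a
    permutation of size [f], to which unavoidability applies. *)
Lemma dilated_additive k l f n (p : 'S_n) d :
  unavoidable k l f -> 0 < d -> d * f <= n ->
  exists2 t : k.-tuple 'I_n, t \in additive_subseqs k l p &
    {in t, forall i, exists j : 'I_f, entry p i = d * j.+1}.
Proof.
move=> unav d_gt0 df_le.
(* The value [v] of one-line notation is the ordinal [v.-1]. *)
have val_lt (j : 'I_f) : (d * j.+1).-1 < n by have := ltn_ord j; nia.
pose pos j := (p^-1)%g (Ordinal (val_lt j)).
have entry_pos j : entry p (pos j) = d * j.+1 by rewrite /entry permKV /=; nia.
have pos_inj : injective pos.
  by move=> i j /(congr1 (entry p)); rewrite !entry_pos => ?; apply: val_inj => /=; nia.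
have [q q_homo] := standardization _ _ pos pos_inj.
have [t] := unav q; rewrite inE => /andP[sorted_t add_t].
exists (map_tuple (fun i => pos (q i)) t); last first.
  by move=> _ /mapP[i _ ->]; exists (q i).
rewrite inE; apply/andP; split.
  rewrite /= -map_comp; move: sorted_t; rewrite !sorted_map.
  by apply: sub_sorted => i j; apply: q_homo.
rewrite /= -map_comp (_ : map _ t = [seq d * x | x <- [seq entry q i | i <- t]]).
  exact: ell_additive_scale.
by rewrite -map_comp; apply: eq_map => i /=; rewrite entry_pos.
Qed.

(** The tuple found for [d], together with the quotient of its first entry by
    [d], gives [d] back, so these pairs are distinct for distinct [d]. *)
Lemma divn_le_F k l f n : 0 < k -> 0 < f -> unavoidable k l f ->
  n %/ f <= F k l n * f.
Proof.
move=> k_gt0 f_gt0 unav; rewrite /F; case: arg_minnP => // p _ _.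
have dil (d : 'I_(n %/ f)) : exists tj : k.-tuple 'I_n * 'I_f,
    tj.1 \in additive_subseqs k l p /\
    head 0 [seq entry p i | i <- tj.1] = d.+1 * tj.2.+1.
  have df_le : d.+1 * f <= n.
    by apply: leq_trans (leq_divM n f); rewrite leq_mul2r ltn_ord orbT.
  have [t t_add t_mul] := dilated_additive _ _ _ _ p _ unav (ltn0Sn d) df_le.
  have := size_tuple t; case def_t: (tval t) => [|x s] size_t.
    by rewrite -size_t in k_gt0.
  have [|j entry_x] := t_mul x; first by rewrite memtE def_t mem_head.
  by exists (t, j); rewrite /= def_t.
have [g gP] := boolp.choice dil.
have g_inj : injective g.
  move=> d e eq_g; have [_ hd] := gP d; have [_ he] := gP e.
  by move: hd; rewrite eq_g he => ?; apply: val_inj => /=; nia.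
rewrite -[X in X <= _]card_ord -(card_imset _ g_inj) /Fp -[X in _ * X]card_ord.
rewrite -cardsT -cardsX; apply/subset_leq_card/subsetP => _ /imsetP[d _ ->].
by rewrite !inE andbT; have [] := gP d; rewrite inE.
Qed.

Local Open Scope ring_scope.

(** In the inductive step the left-hand side grows by the factor
    [(m + 1) * (1 + 1 / m) ^ m], and [(1 + 1 / m) ^ m <= e]. *)
Lemma exprnn_le_fact_expR (R : realType) (m : nat) :
  m%:R ^+ m <= m`!%:R * expR 1 ^+ m :> R.
Proof.
elim: m => [|m IHm]; first by rewrite !expr0 fact0 mulr1.
have step : m.+1%:R ^+ m <= expR 1 * m%:R ^+ m :> R.
  case: m {IHm} => [|m]; first by rewrite !expr0 mulr1; have := expR_ge1Dx (1 : R); lra.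
  have m_gt0 : 0 < m.+1%:R :> R by rewrite ltr0n.
  have : (1 + m.+1%:R^-1) ^+ m.+1 <= expR (m.+1%:R^-1) ^+ m.+1 :> R.
    by rewrite lerXn2r ?nnegrE ?expR_ge0 ?expR_ge1Dx// addr_ge0 ?invr_ge0// ltW.
  rewrite -expRM_natl divff ?gt_eqF// => le_e.
  have -> : m.+2%:R = (1 + m.+1%:R^-1) * m.+1%:R :> R.
    by rewrite mulrDl mul1r mulVf ?gt_eqF// -[m.+2]addn1 natrD.
  by rewrite exprMn ler_pM2r ?exprn_gt0.
rewrite exprS factS natrM exprS -!mulrA ler_pM2l ?ltr0n//.
by apply: le_trans step _; rewrite mulrCA ler_pM2l ?expR_gt0.
Qed.

Lemma bin_le_expR (R : realType) (n m : nat) : (0 < m)%N ->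
  'C(n, m)%:R <= (expR 1 / m%:R) ^+ m * n%:R ^+ m :> R.
Proof.
move=> m_gt0.
have ffact_le : (n ^_ m <= n ^ m)%N.
  rewrite ffact_prod -[X in (_ <= _ ^ X)%N]card_ord -prod_nat_const.
  by apply: leq_prod => i _; rewrite leq_subr.
have fact_pos : 0 < m`!%:R :> R by rewrite ltr0n fact_gt0.
have mm_pos : 0 < m%:R ^+ m :> R by rewrite exprn_gt0 ?ltr0n.
rewrite expr_div_n mulrAC ler_pdivlMr// -(ler_pM2r fact_pos).
have -> : 'C(n, m)%:R * m%:R ^+ m * m`!%:R = (n ^_ m)%:R * m%:R ^+ m :> R.
  by rewrite mulrAC -natrM bin_ffact.
have -> : expR 1 ^+ m * n%:R ^+ m * m`!%:R =
    n%:R ^+ m * (m`!%:R * expR 1 ^+ m) :> R by ring.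
apply: ler_pM; rewrite ?exprn_ge0 ?ler0n ?exprnn_le_fact_expR//.
by rewrite -natrX ler_nat.
Qed.

(** Once [n >= f * exp (2 f)], the denominator [f * (ln n - ln f + 2)] is at
    least [2 f ^ 2], so the first term takes up at most half of the right-hand
    side; the other half eventually exceeds the constant [C]. *)
Lemma eventually_le_linear (R : realType) (f : nat) (C : R) : (0 < f)%N ->
  exists N : nat, forall n : nat, (N <= n)%N ->
    n%:R / (f%:R * (ln n%:R - ln f%:R + 2)) + C <= n%:R / f%:R ^+ 2.
Proof.
move=> f_gt0; have f_pos : 0 < f%:R :> R by rewrite ltr0n.
pose B : R := f%:R * expR (2 * f%:R).
pose D : R := `|C| * (2 * f%:R ^+ 2).
have B_pos : 0 < B by rewrite mulr_gt0 ?expR_gt0.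
have D_ge0 : 0 <= D by rewrite mulr_ge0// mulr_ge0// exprn_ge0// ltW.
exists (Num.bound (B + D)) => n le_Nn.
have n_gt : B + D < n%:R :> R.
  apply: lt_le_trans (archi_boundP _) _; first by lra.
  by rewrite ler_nat.
have L_ge : 2 * f%:R <= ln n%:R - ln f%:R + 2 :> R.
  have : ln B <= ln n%:R by rewrite ler_ln ?posrE; lra.
  by rewrite lnM ?posrE ?expR_gt0// expRK; lra.
have half : n%:R / (f%:R * (ln n%:R - ln f%:R + 2)) <= n%:R / (2 * f%:R ^+ 2) :> R.
  rewrite ler_pM2l; last by lra.
  rewrite lef_pV2 ?posrE; first by nra.
  - by apply: mulr_gt0; lra.
  - by rewrite mulr_gt0// exprn_gt0.
have C_le : C <= n%:R / (2 * f%:R ^+ 2).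
  rewrite ler_pdivlMr; last by rewrite mulr_gt0// exprn_gt0.
  apply: (@le_trans _ _ D); last by lra.
  by rewrite ler_wpM2r ?ler_norm// mulr_ge0// exprn_ge0// ltW.
have -> : n%:R / f%:R ^+ 2 = n%:R / (2 * f%:R ^+ 2) + n%:R / (2 * f%:R ^+ 2) :> R.
  by field; rewrite gt_eqF.
exact: lerD.
Qed.

Theorem theorem4p4 (R : realType) :
  (forall k l n : nat, (2 <= k)%N -> (0 < l)%N -> (0 < n)%N ->
     (F k l n)%:R <=
       2 / k%:R * (expR 1 / (k%:R - 1)) ^+ (k - 1) * n%:R ^+ (k - 1) :> R)
  /\
  (forall k l f : nat, (0 < k)%N -> (0 < l)%N -> is_f k l f ->
     exists N : nat, forall n : nat, (N <= n)%N ->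
       (F k l n)%:R >=
         n%:R / (f%:R * (ln n%:R - ln f%:R + 2))
         - f%:R / (ln f%:R - 4) + 1 :> R).
Proof.
split=> [k l n k_ge2 _ _|k l f k_gt0 _ [f_gt0 unav _]].
  have k_pos : 0 < k%:R :> R by rewrite ltr0n; lia.
  have -> : k%:R - 1 = (k - 1)%:R :> R by rewrite natrB//; lia.
  apply: (@le_trans _ _ (2 / k%:R * 'C(n, k - 1)%:R)); last first.
    rewrite -[leRHS]mulrA ler_pM2l; last by rewrite divr_gt0.
    by apply: bin_le_expR; lia.
  rewrite mulrAC ler_pdivlMr// mulrC -!natrM ler_nat subn1.
  exact: F_le_bin.
have f_pos : 0 < f%:R :> R by rewrite ltr0n.
have [N N_large] :=
  eventually_le_linear R f (- (f%:R / (ln f%:R - 4)) + 1 + f%:R^-1) f_gt0.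
exists N => n /N_large le_lin.
have lower : n%:R / f%:R ^+ 2 - f%:R^-1 <= (F k l n)%:R :> R.
  (* From [n < (n %/ f + 1) * f] and [n %/ f <= F k l n * f]. *)
  have n_le : (n <= F k l n * f ^ 2 + f)%N.
    have := divn_le_F k l f n k_gt0 f_gt0 unav.
    by have := ltn_ceil n f_gt0; nia.
  have -> : n%:R / f%:R ^+ 2 - f%:R^-1 = (n%:R - f%:R) / f%:R ^+ 2 :> R.
    by field; rewrite gt_eqF.
  rewrite ler_pdivrMr ?exprn_gt0// lerBlDr -natrX -natrM -natrD ler_nat.
  exact: n_le.
lra.
Qed.
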